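(* Let $\mathcal{I}_{Lip}^{1},\mathcal{I}_{Lip}^{2}$ be normed Lipschitz operator ideals, $X_1,X_2$ pointed metric spaces and $E$ a Banach space. (1) $[\mathcal{I}_{Lip}^{1},\mathcal{I}_{Lip}^{2}](X_1,X_2;E)$ is a linear subspace of $BLip_0(X_1,X_2;E)$. (2) $\|\cdot\|_{[\mathcal{I}_{Lip}^{1},\mathcal{I}_{Lip}^{2}]}$ is a norm on $[\mathcal{I}_{Lip}^{1},\mathcal{I}_{Lip}^{2}](X_1,X_2;E)$. (3) (Ideal property) Let $Z,W$ be pointed metric spaces, $F$ a Banach space, $f\in Lip_0(Z,X_1)$, $g\in Lip_0(W,X_2)$ and $u\in\mathcal{L}(E,F)$. If $T\in[\mathcal{I}_{Lip}^{1},\mathcal{I}_{Lip}^{2}](X_1,X_2;E)$, then $u\circ T\circ(f,g)\in[\mathcal{I}_{Lip}^{1},\mathcal{I}_{Lip}^{2}](Z,W;F)$ and $$\|u\circ T\circ(f,g)\|_{[\mathcal{I}_{Lip}^{1},\mathcal{I}_{Lip}^{2}]}\le\|u\|\,\|T\|_{[\mathcal{I}_{Lip}^{1},\mathcal{I}_{Lip}^{2}]}\,Lip(f)\,Lip(g).$$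
   Context: Let $\mathbb{K}$ be $\mathbb{R}$ or $\mathbb{C}$; all Banach spaces are over $\mathbb{K}$. A pointed metric space is a metric space with a distinguished base point $0$. $Lip_0(X,Y)$ is the set of Lipschitz maps $T:X\to Y$ with $T(0)=0$ and $Lip(T)$ is the least Lipschitz constant; for a Banach space $E$, $Lip_0(X,E)$ is a Banach space under $Lip(\cdot)$; $X^{\#}=Lip_0(X,\mathbb{K})$. $\mathcal{L}(E,F)$ is the space of bounded linear operators. A map $T:X_1\times X_2\to E$ belongs to $BLip_0(X_1,X_2;E)$ if $T(x_1,0)=T(0,x_2)=0$ for all $x_1,x_2$ and there is $C>0$ with $\|T(x_1,x_2)-T(x_1,x_2')-T(x_1',x_2)+T(x_1',x_2')\|\le C\,d(x_1,x_1')d(x_2,x_2')$ for all $x_1,x_1'\in X_1$, $x_2,x_2'\in X_2$. The least such $C$ is the norm $BLip(T)$. A Lipschitz operator ideal $\mathcal{I}_{Lip}$ is a subclass of $Lip_0$ such that for every pointed metric space $X$ and Banach space $E$ the components $\mathcal{I}_{Lip}(X,E):=Lip_0(X,E)\cap\mathcal{I}_{Lip}$ satisfy: (i) $\mathcal{I}_{Lip}(X,E)$ is a linear subspace of $Lip_0(X,E)$; (ii) $vg:x\mapsto g(x)v$ belongs to $\mathcal{I}_{Lip}(X,E)$ for $v\in E$, $g\in X^{\#}$; (iii) if $S\in Lip_0(Y,X)$, $T\in\mathcal{I}_{Lip}(X,E)$, $w\in\mathcal{L}(E,F)$, then $wTS\in\mathcal{I}_{Lip}(Y,F)$. It is normed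 if there is $\|\cdot\|_{\mathcal{I}_{Lip}}:\mathcal{I}_{Lip}\to[0,\infty)$ such that each $(\mathcal{I}_{Lip}(X,E),\|\cdot\|_{\mathcal{I}_{Lip}})$ is a normed space with $Lip(T)\le\|T\|_{\mathcal{I}_{Lip}}$; $\|Id_{\mathbb{K}}\|_{\mathcal{I}_{Lip}}=1$; and $\|wTS\|_{\mathcal{I}_{Lip}}\le Lip(S)\|T\|_{\mathcal{I}_{Lip}}\|w\|$. Lipschitzization method: each $T\in BLip_0(X_1,X_2;E)$ has associated maps $T_1\in Lip_0(X_1,Lip_0(X_2,E))$ and $T_2\in Lip_0(X_2,Lip_0(X_1,E))$, $T_1(x_1)(x_2)=T(x_1,x_2)=T_2(x_2)(x_1)$. For Lipschitz operator ideals $\mathcal{I}_{Lip}^{1},\mathcal{I}_{Lip}^{2}$, $T\in[\mathcal{I}_{Lip}^{1},\mathcal{I}_{Lip}^{2}](X_1,X_2;E)$ iff $T_1\in\mathcal{I}_{Lip}^{1}(X_1,Lip_0(X_2,E))$ and $T_2\in\mathcal{I}_{Lip}^{2}(X_2,Lip_0(X_1,E))$; in the normed case $\|T\|_{[\mathcal{I}_{Lip}^{1},\mathcal{I}_{Lip}^{2}]}=\max\{\|T_1\|_{\mathcal{I}_{Lip}^{1}},\|T_2\|_{\mathcal{I}_{Lip}^{2}}\}$. *)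

(* Defs.v *)
From Stdlib Require Import Reals Lra.
From Stdlib Require Import FunctionalExtensionality PropExtensionality.
From Stdlib Require Import ProofIrrelevance ClassicalEpsilon.
From Corelib Require Import ssreflect.
From Coquelicot Require Export Coquelicot.

Local Set Warnings "-ambiguous-paths,-uniform-inheritance".
Local Open Scope R_scope.

Variant scalar_field := real_scalars | complex_scalars.

Definition scalars (k : scalar_field) : AbsRing :=
  match k with
  | real_scalars => R_AbsRing
  | complex_scalars => C_AbsRing
  end.

Definition scalar_banach (k : scalar_field) :
    CompleteNormedModule (scalars k) :=
  match k with
  | real_scalars => R_CompleteNormedModule
  | complex_scalars => C_CompleteNormedModule
  end.

(* A Banach space over K is a [CompleteNormedModule K]. The metric used below is
   always the one of the norm, not the uniform balls of the structure, which
   are only equivalent to the norm balls. *)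

Definition linear_subspace {K : AbsRing} {V : ModuleSpace K} (P : V -> Prop) :
    Prop :=
  P zero /\
  (forall x y, P x -> P y -> P (plus x y)) /\
  (forall a x, P x -> P (scal a x)).

(* [n] is a total function, but only its values on [P] are constrained. *)
Definition is_norm_on {K : AbsRing} {V : ModuleSpace K} (P : V -> Prop)
    (n : V -> R) : Prop :=
  (forall x, P x -> 0 <= n x) /\
  (forall x, P x -> (n x = 0 <-> x = zero)) /\
  (forall a x, P x -> n (scal a x) = abs a * n x) /\
  (forall x y, P x -> P y -> n (plus x y) <= n x + n y).

(* The infimum of the nonnegative bounds in [P]. The clause [0 <= c] matters:
   over a one-point metric space every real, even a negative one, is a
   Lipschitz constant. *)
Definition least_bound (P : R -> Prop) : R :=
  real (Glb_Rbar (fun c => 0 <= c /\ P c)).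

Lemma least_bound_ge0 P : 0 <= least_bound P.
Proof.
unfold least_bound.
destruct (Glb_Rbar_correct (fun c => 0 <= c /\ P c)) as [_ H].
destruct (Glb_Rbar _) as [l| |]; simpl; try lra.
exact (H (Finite 0) (fun x Hx => proj1 Hx)).
Qed.

Lemma least_bound_le P c : 0 <= c -> P c -> least_bound P <= c.
Proof.
intros c0 Pc; unfold least_bound.
destruct (Glb_Rbar_correct (fun c => 0 <= c /\ P c)) as [H _].
specialize (H c (conj c0 Pc)).
destruct (Glb_Rbar _) as [l| |]; simpl in *; try lra; tauto.
Qed.

Lemma least_bound_glb P b :
  (exists c, 0 <= c /\ P c) -> (forall c, 0 <= c -> P c -> b <= c) ->
  b <= least_bound P.
Proof.
intros [c [c0 Pc]] Hb; unfold least_bound.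
destruct (Glb_Rbar_correct (fun c => 0 <= c /\ P c)) as [H1 H2].
assert (Hlb : Rbar_le b (Glb_Rbar (fun c => 0 <= c /\ P c))).
{ apply H2; intros x [x0 Px]; exact (Hb x x0 Px). }
specialize (H1 c (conj c0 Pc)).
destruct (Glb_Rbar _) as [l| |]; simpl in *; try lra; tauto.
Qed.

Coercion Base : Metric_Space >-> Sortclass.

Record pointed_metric := PointedMetric {
  pm_space :> Metric_Space;
  base_point : pm_space
}.

Section BanachMetric.
Context {K : AbsRing} (E : CompleteNormedModule K).

Definition norm_dist (x y : E) : R := norm (minus x y).

Lemma norm_minus_sym (x y : E) : norm (minus x y) = norm (minus y x).
Proof. now rewrite -norm_opp opp_minus. Qed.

Lemma norm_dist_pos x y : norm_dist x y >= 0.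
Proof. apply Rle_ge, norm_ge_0. Qed.

Lemma norm_dist_sym x y : norm_dist x y = norm_dist y x.
Proof. apply norm_minus_sym. Qed.

Lemma minus_eq_zero_inv (x y : E) : minus x y = zero -> x = y.
Proof.
intros H.
replace x with (plus (minus x y) y).
- now rewrite H plus_zero_l.
- unfold minus; now rewrite -plus_assoc plus_opp_l plus_zero_r.
Qed.

Lemma norm_dist_refl x y : norm_dist x y = 0 <-> x = y.
Proof.
unfold norm_dist; split; intros H.
- apply minus_eq_zero_inv, (@norm_eq_zero K E); exact H.
- rewrite H minus_eq_zero; apply (@norm_zero K E).
Qed.

Lemma norm_dist_tri x y z : norm_dist x y <= norm_dist x z + norm_dist z y.
Proof.
unfold norm_dist; rewrite (minus_trans z x y); apply (@norm_triangle K E).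
Qed.

Definition norm_metric : Metric_Space :=
  Build_Metric_Space E norm_dist norm_dist_pos norm_dist_sym norm_dist_refl
    norm_dist_tri.

Definition banach_pm : pointed_metric := PointedMetric norm_metric zero.

End BanachMetric.

Coercion banach_pm : CompleteNormedModule.type >-> pointed_metric.

Definition lipschitz_with {X Y : Metric_Space} (f : X -> Y) (L : R) : Prop :=
  forall x x', dist Y (f x) (f x') <= L * dist X x x'.

Record Lip0 (X Y : pointed_metric) := MkLip0 {
  lip_fun :> X -> Y;
  lip_bound : exists L, lipschitz_with lip_fun L;
  lip_base : lip_fun (base_point X) = base_point Y
}.

Arguments MkLip0 {X Y}.
Arguments lip_fun {X Y}.
Arguments lip_bound {X Y}.
Arguments lip_base {X Y}.

Definition Lip {X Y : pointed_metric} (f : Lip0 X Y) : R :=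
  least_bound (lipschitz_with f).

Section LipBasics.
Context {X Y : pointed_metric}.
Implicit Types f g : Lip0 X Y.

Lemma Lip0_ext f g : (forall x, f x = g x) -> f = g.
Proof.
destruct f as [f Hf f0], g as [g Hg g0]; simpl; intros H.
assert (f = g) by now apply functional_extensionality.
subst g; f_equal; apply proof_irrelevance.
Qed.

Lemma lip_bound_ge0 f : exists L, 0 <= L /\ lipschitz_with f L.
Proof.
destruct (lip_bound f) as [L HL].
exists (Rmax 0 L); split; [apply Rmax_l|].
intros x x'; apply Rle_trans with (1 := HL x x').
apply Rmult_le_compat_r; [apply Rge_le, dist_pos | apply Rmax_r].
Qed.

Lemma Lip_ge0 f : 0 <= Lip f.
Proof. apply least_bound_ge0. Qed.

Lemma Lip_le f c : 0 <= c -> lipschitz_with f c -> Lip f <= c.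
Proof. apply least_bound_le. Qed.

Lemma Lip_spec f : lipschitz_with f (Lip f).
Proof.
intros x x'.
destruct (Rle_lt_or_eq_dec 0 (dist X x x') (Rge_le _ _ (dist_pos X x x')))
  as [Hd | Hd].
- apply Rle_div_l; [exact Hd|].
  apply least_bound_glb; [apply lip_bound_ge0|].
  intros c c0 Hc; apply Rle_div_l; [exact Hd|apply Hc].
- symmetry in Hd; rewrite Hd Rmult_0_r.
  apply dist_refl in Hd; subst x'.
  apply Req_le, dist_refl; reflexivity.
Qed.

End LipBasics.

Lemma minus_plus_plus {G : AbelianGroup} (a b c e : G) :
  minus (plus a b) (plus c e) = plus (minus a c) (minus b e).
Proof.
unfold minus; rewrite opp_plus -!plus_assoc; f_equal.
now rewrite !plus_assoc (plus_comm b).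
Qed.

Lemma minus_plus_cancel {G : AbelianGroup} (a b : G) :
  plus (minus a b) b = a.
Proof. unfold minus; now rewrite -plus_assoc plus_opp_l plus_zero_r. Qed.

Lemma minus_opp_opp {G : AbelianGroup} (a b : G) :
  minus (opp a) (opp b) = opp (minus a b).
Proof. unfold minus; now rewrite opp_plus. Qed.

Section LipSpace.
Context {K : AbsRing} {X : pointed_metric} {E : CompleteNormedModule K}.
Implicit Types f g h : Lip0 X E.

Lemma lip0_zero_bound :
  exists L, lipschitz_with (fun _ : X => base_point E) L.
Proof.
exists 0; intros x x'.
rewrite Rmult_0_l; apply Req_le, dist_refl; reflexivity.
Qed.

Definition lip0_zero : Lip0 X E :=
  MkLip0 (fun _ : X => base_point E) lip0_zero_bound eq_refl.

Lemma lip0_plus_bound f g :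
  lipschitz_with (Y := E) (fun x => plus (f x : E) (g x : E)) (Lip f + Lip g).
Proof.
intros x x'; simpl; unfold norm_dist; rewrite minus_plus_plus.
apply Rle_trans with (1 := @norm_triangle K E _ _).
rewrite Rmult_plus_distr_r.
exact (Rplus_le_compat _ _ _ _ (Lip_spec f x x') (Lip_spec g x x')).
Qed.

Lemma lip0_plus_base f g :
  plus (f (base_point X) : E) (g (base_point X) : E) = base_point E.
Proof. rewrite !lip_base; apply plus_zero_l. Qed.

Definition lip0_plus f g : Lip0 X E :=
  MkLip0 (Y := E) (fun x => plus (f x : E) (g x : E))
    (ex_intro _ _ (lip0_plus_bound f g)) (lip0_plus_base f g).

Lemma lip0_opp_bound f :
  lipschitz_with (Y := E) (fun x => opp (f x : E)) (Lip f).
Proof.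
intros x x'; simpl; unfold norm_dist.
rewrite minus_opp_opp norm_opp; exact (Lip_spec f x x').
Qed.

Lemma lip0_opp_base f : opp (f (base_point X) : E) = base_point E.
Proof. rewrite lip_base; apply (@opp_zero E). Qed.

Definition lip0_opp f : Lip0 X E :=
  MkLip0 (Y := E) (fun x => opp (f x : E))
    (ex_intro _ _ (lip0_opp_bound f)) (lip0_opp_base f).

Lemma lip0_scal_bound (a : K) f :
  lipschitz_with (Y := E) (fun x => scal a (f x : E)) (abs a * Lip f).
Proof.
intros x x'; simpl; unfold norm_dist.
rewrite -(@scal_minus_distr_l K E).
apply Rle_trans with (1 := @norm_scal _ E _ _).
rewrite Rmult_assoc.
apply Rmult_le_compat_l; [apply abs_ge_0 | exact (Lip_spec f x x')].
Qed.

Lemma lip0_scal_base (a : K) f :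
  scal a (f (base_point X) : E) = base_point E.
Proof. rewrite lip_base; apply (@scal_zero_r K E). Qed.

Definition lip0_scal (a : K) f : Lip0 X E :=
  MkLip0 (Y := E) (fun x => scal a (f x : E))
    (ex_intro _ _ (lip0_scal_bound a f)) (lip0_scal_base a f).

Lemma lip0_plus_comm f g : lip0_plus f g = lip0_plus g f.
Proof. apply Lip0_ext; intros x; apply (@plus_comm E). Qed.

Lemma lip0_plus_assoc f g h :
  lip0_plus f (lip0_plus g h) = lip0_plus (lip0_plus f g) h.
Proof. apply Lip0_ext; intros x; apply (@plus_assoc E). Qed.

Lemma lip0_plus_zero_r f : lip0_plus f lip0_zero = f.
Proof. apply Lip0_ext; intros x; apply (@plus_zero_r E). Qed.

Lemma lip0_plus_opp_r f : lip0_plus f (lip0_opp f) = lip0_zero.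
Proof. apply Lip0_ext; intros x; apply (@plus_opp_r E). Qed.

Definition lip0_AbelianMonoid_mixin :=
  AbelianMonoid.Mixin (Lip0 X E) lip0_plus lip0_zero lip0_plus_comm
    lip0_plus_assoc lip0_plus_zero_r.

Canonical lip0_AbelianMonoid :=
  AbelianMonoid.Pack (Lip0 X E) lip0_AbelianMonoid_mixin (Lip0 X E).

Definition lip0_AbelianGroup_mixin :=
  AbelianGroup.Mixin lip0_AbelianMonoid lip0_opp lip0_plus_opp_r.

Canonical lip0_AbelianGroup :=
  AbelianGroup.Pack (Lip0 X E)
    (AbelianGroup.Class _ lip0_AbelianMonoid_mixin lip0_AbelianGroup_mixin)
    (Lip0 X E).

Lemma lip0_scal_assoc (a b : K) f :
  lip0_scal a (lip0_scal b f) = lip0_scal (mult a b) f.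
Proof. apply Lip0_ext; intros x; apply (@scal_assoc K E). Qed.

Lemma lip0_scal_one f : lip0_scal one f = f.
Proof. apply Lip0_ext; intros x; apply (@scal_one K E). Qed.

Lemma lip0_scal_distr_l (a : K) f g :
  lip0_scal a (lip0_plus f g) = lip0_plus (lip0_scal a f) (lip0_scal a g).
Proof. apply Lip0_ext; intros x; apply (@scal_distr_l K E). Qed.

Lemma lip0_scal_distr_r (a b : K) f :
  lip0_scal (plus a b) f = lip0_plus (lip0_scal a f) (lip0_scal b f).
Proof. apply Lip0_ext; intros x; apply (@scal_distr_r K E). Qed.

Definition lip0_ModuleSpace_mixin :=
  ModuleSpace.Mixin K lip0_AbelianGroup lip0_scal lip0_scal_assoc
    lip0_scal_one lip0_scal_distr_l lip0_scal_distr_r.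

Definition lip0_ModuleSpace_class :=
  ModuleSpace.Class K (Lip0 X E)
    (AbelianGroup.Class _ lip0_AbelianMonoid_mixin lip0_AbelianGroup_mixin)
    lip0_ModuleSpace_mixin.

Canonical lip0_ModuleSpace :=
  ModuleSpace.Pack K (Lip0 X E) lip0_ModuleSpace_class (Lip0 X E).

Definition lip0_ball f (eps : R) g : Prop := Lip (minus g f) < eps.

Lemma Lip_triangle f g : Lip (plus f g) <= Lip f + Lip g.
Proof.
apply Lip_le.
- apply Rplus_le_le_0_compat; apply Lip_ge0.
- apply lip0_plus_bound.
Qed.

Lemma Lip_scal (a : K) f : Lip (scal a f) <= abs a * Lip f.
Proof.
apply Lip_le.
- apply Rmult_le_pos; [apply abs_ge_0 | apply Lip_ge0].
- apply lip0_scal_bound.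
Qed.

Lemma Lip_opp f : Lip (opp f) <= Lip f.
Proof. apply Lip_le; [apply Lip_ge0 | apply lip0_opp_bound]. Qed.

Lemma Lip_zero : Lip (zero : Lip0 X E) = 0.
Proof.
apply Rle_antisym; [|apply Lip_ge0].
apply Lip_le; [lra|].
intros x x'; rewrite Rmult_0_l; apply Req_le, dist_refl; reflexivity.
Qed.

Lemma Lip_norm_le f x : norm (f x : E) <= Lip f * dist X x (base_point X).
Proof.
assert (H := Lip_spec f x (base_point X)).
rewrite lip_base in H; simpl in H; unfold norm_dist in H.
now rewrite (@minus_zero_r E) in H.
Qed.

Lemma Lip_eq_zero f : Lip f = 0 -> f = zero.
Proof.
intros H; apply Lip0_ext; intros x; apply (@norm_eq_zero K E).
apply Rle_antisym; [|apply norm_ge_0].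
apply Rle_trans with (1 := Lip_norm_le f x); rewrite H; lra.
Qed.

Lemma lip0_ball_center f (e : posreal) : lip0_ball f e f.
Proof.
unfold lip0_ball; rewrite minus_eq_zero Lip_zero; apply cond_pos.
Qed.

Lemma lip0_ball_sym f g (e : R) : lip0_ball f e g -> lip0_ball g e f.
Proof.
unfold lip0_ball; intros H.
rewrite -opp_minus; apply Rle_lt_trans with (1 := Lip_opp _); exact H.
Qed.

Lemma lip0_ball_triangle f g h (e1 e2 : R) :
  lip0_ball f e1 g -> lip0_ball g e2 h -> lip0_ball f (e1 + e2) h.
Proof.
unfold lip0_ball; intros H1 H2; rewrite (minus_trans g h f).
apply Rle_lt_trans with (1 := Lip_triangle _ _); lra.
Qed.

Definition lip0_UniformSpace_mixin :=
  UniformSpace.Mixin (Lip0 X E) lip0_zero lip0_ball lip0_ball_center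
    lip0_ball_sym lip0_ball_triangle.

Canonical lip0_UniformSpace :=
  UniformSpace.Pack (Lip0 X E) lip0_UniformSpace_mixin (Lip0 X E).

Definition lip0_NormedModuleAux_class :=
  NormedModuleAux.Class K (Lip0 X E) lip0_ModuleSpace_class
    lip0_UniformSpace_mixin.

Canonical lip0_NormedModuleAux :=
  NormedModuleAux.Pack K (Lip0 X E) lip0_NormedModuleAux_class (Lip0 X E).

Lemma lip0_ball_norm f g (eps : posreal) :
  ball f eps g -> Lip (minus g f) < 1 * eps.
Proof. rewrite Rmult_1_l; intros H; exact H. Qed.

Definition lip0_NormedModule_mixin :=
  NormedModule.Mixin K lip0_NormedModuleAux Lip 1 Lip_triangle Lip_scal
    (fun f g eps H => H) lip0_ball_norm Lip_eq_zero.

Definition lip0_NormedModule_class :=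
  NormedModule.Class K (Lip0 X E) lip0_NormedModuleAux_class
    lip0_NormedModule_mixin.

Canonical lip0_NormedModule :=
  NormedModule.Pack K (Lip0 X E) lip0_NormedModule_class (Lip0 X E).

Lemma lip0_cauchy_pointwise (F : (Lip0 X E -> Prop) -> Prop) (x : X) :
  ProperFilter F -> cauchy F ->
  exists y : E, forall eta : R, 0 < eta ->
    F (fun f => norm (minus (f x : E) y) < eta).
Proof.
intros FF CF.
set (G := filtermap (fun f : Lip0 X E => (f x : E)) F).
assert (FG : ProperFilter G) by (apply filtermap_proper_filter; exact FF).
assert (CG : cauchy G).
{ intros eps.
  assert (Dp : 0 < dist X x (base_point X) + 1)
    by (assert (H := dist_pos X x (base_point X)); lra).
  assert (Hd : 0 < eps / (dist X x (base_point X) + 1))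
    by (apply Rdiv_lt_0_compat; [apply cond_pos | exact Dp]).
  destruct (CF (mkposreal _ Hd)) as [h Hh].
  exists (h x : E); unfold G, filtermap.
  apply filter_imp with (2 := Hh); intros f Hf.
  apply (@norm_compat1 K E).
  change (lip0_ball h (eps / (dist X x (base_point X) + 1)) f) in Hf.
  apply Rle_lt_trans with (1 := Lip_norm_le (minus f h) x).
  apply Rle_lt_trans with
    (Lip (minus f h) * (dist X x (base_point X) + 1)).
  - apply Rmult_le_compat_l; [apply Lip_ge0 | lra].
  - apply Rlt_div_r; [exact Dp | exact Hf]. }
exists (lim G); intros eta Heta.
assert (He : 0 < eta / @norm_factor K E)
  by (apply Rdiv_lt_0_compat; [exact Heta | apply norm_factor_gt_0]).
assert (H := complete_cauchy G FG CG (mkposreal _ He)).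
change (F (fun f => ball (lim G) (mkposreal _ He) (f x : E))) in H.
apply filter_imp with (2 := H); intros f Hf.
apply (@norm_compat2 K E) in Hf; simpl in Hf.
replace eta with (@norm_factor K E * (eta / @norm_factor K E)); [exact Hf|].
field; apply Rgt_not_eq, norm_factor_gt_0.
Qed.

Lemma lip0_cauchy_limit (F : (Lip0 X E -> Prop) -> Prop) :
  ProperFilter F -> cauchy F ->
  exists f : Lip0 X E, forall eps : posreal, F (ball f eps).
Proof.
intros FF CF.
set (L x := constructive_indefinite_description _
  (lip0_cauchy_pointwise F x FF CF)).
set (l x := proj1_sig (L x)).
assert (Hl : forall x (eta : R), 0 < eta ->
    F (fun f => norm (minus (f x : E) (l x)) < eta))
  by (intros x; exact (proj2_sig (L x))).
clearbody l; clear L.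
assert (Hclose : forall (h : Lip0 X E) (e : posreal), F (ball h e) ->
  forall x x', norm (minus (minus (l x) (h x : E)) (minus (l x') (h x' : E)))
    <= e * dist X x x').
{ intros h e Hh x x'.
  apply le_epsilon; intros eta Heta.
  assert (Heta2 : 0 < eta / 2) by lra.
  destruct (filter_ex _ (filter_and _ _ Hh
    (filter_and _ _ (Hl x _ Heta2) (Hl x' _ Heta2)))) as [g [Hg [Hx Hx']]].
  assert (Hgh := Lip_spec (minus g h) x x').
  simpl in Hgh; unfold norm_dist in Hgh.
  change (norm (minus (minus (g x : E) (h x : E)) (minus (g x' : E) (h x' : E)))
    <= Lip (minus g h) * dist X x x') in Hgh.
  change (Lip (minus g h) < e) in Hg.
  assert (Hm : Lip (minus g h) * dist X x x' <= e * dist X x x')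
    by (apply Rmult_le_compat_r; [apply Rge_le, dist_pos | lra]).
  assert (Heq : minus (minus (l x) (h x : E)) (minus (l x') (h x' : E)) =
    plus (minus (minus (g x : E) (h x : E)) (minus (g x' : E) (h x' : E)))
      (plus (minus (l x) (g x : E)) (minus (g x' : E) (l x')))).
  { rewrite (minus_trans (g x : E) (l x) (h x : E)).
    rewrite (minus_trans (g x' : E) (l x') (h x' : E)).
    rewrite minus_plus_plus plus_comm; f_equal.
    unfold minus at 1; now rewrite opp_minus. }
  rewrite Heq.
  apply Rle_trans with (1 := @norm_triangle K E _ _).
  assert (H3 := @norm_triangle K E (minus (l x) (g x : E)) (minus (g x' : E) (l x'))).
  rewrite (norm_minus_sym E (l x)) in H3.
  apply Rle_trans with (e * dist X x x' + (eta / 2 + eta / 2)); [|lra].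
  apply Rplus_le_compat; [exact (Rle_trans _ _ _ Hgh Hm)|].
  apply (Rle_trans _ _ _ H3); lra. }
destruct (CF (mkposreal 1 Rlt_0_1)) as [h0 Hh0].
assert (Hlip : lipschitz_with (Y := E) (X := X) l (1 + Lip h0)).
{ intros x x'; simpl; unfold norm_dist.
  assert (H1 := Hclose h0 _ Hh0 x x'); simpl in H1.
  assert (H2 := Lip_spec h0 x x'); simpl in H2; unfold norm_dist in H2.
  assert (Heq : minus (l x) (l x') =
    plus (minus (minus (l x) (h0 x : E)) (minus (l x') (h0 x' : E)))
      (minus (h0 x : E) (h0 x' : E))).
  { now rewrite -minus_plus_plus !minus_plus_cancel. }
  rewrite Heq.
  apply Rle_trans with (1 := @norm_triangle K E _ _).
  rewrite Rmult_plus_distr_r; exact (Rplus_le_compat _ _ _ _ H1 H2). }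
assert (Hbase : l (base_point X) = base_point E).
{ apply (@norm_eq_zero K E).
  apply Rle_antisym; [|apply norm_ge_0].
  apply le_epsilon; intros eta Heta.
  destruct (filter_ex _ (Hl (base_point X) _ Heta)) as [g Hg].
  rewrite lip_base (@norm_minus_sym K E) in Hg.
  simpl in Hg; rewrite (@minus_zero_r E) in Hg; lra. }
set (f := MkLip0 (Y := E) l (ex_intro _ _ Hlip) Hbase).
exists f; intros eps.
assert (He : 0 < eps / 2) by (assert (H := cond_pos eps); lra).
destruct (CF (mkposreal _ He)) as [h Hh].
apply filter_imp with (2 := Hh); intros g Hg.
assert (Hhf : Lip (minus f h) <= eps / 2).
{ apply Lip_le; [lra|].
  intros x x'; exact (Hclose h _ Hh x x'). }
change (Lip (minus g h) < eps / 2) in Hg.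
change (Lip (minus g f) < eps).
rewrite (minus_trans h g f).
apply Rle_lt_trans with (1 := Lip_triangle _ _).
assert (Hfh := Lip_opp (minus f h)); rewrite opp_minus in Hfh.
change (Lip (minus h f) <= Lip (minus f h)) in Hfh; lra.
Qed.

Definition lip0_lim (F : (Lip0 X E -> Prop) -> Prop) : Lip0 X E :=
  epsilon (inhabits lip0_zero)
    (fun f => forall eps : posreal, F (ball f eps)).

Lemma lip0_complete_cauchy (F : (Lip0 X E -> Prop) -> Prop) :
  ProperFilter F -> cauchy F ->
  forall eps : posreal, F (ball (lip0_lim F) eps).
Proof.
intros FF CF.
exact (epsilon_spec (inhabits lip0_zero) _ (lip0_cauchy_limit F FF CF)).
Qed.

Lemma lip0_close_lim (F1 F2 : (Lip0 X E -> Prop) -> Prop) :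
  filter_le F1 F2 -> filter_le F2 F1 -> close (lip0_lim F1) (lip0_lim F2).
Proof.
intros H12 H21.
replace F2 with F1; [apply close_refl|].
apply functional_extensionality; intros P.
apply propositional_extensionality; split; [apply H21 | apply H12].
Qed.

Definition lip0_CompleteSpace_mixin :=
  CompleteSpace.Mixin lip0_UniformSpace lip0_lim lip0_complete_cauchy
    lip0_close_lim.

Canonical lip0_CompleteNormedModule :=
  CompleteNormedModule.Pack K (Lip0 X E)
    (CompleteNormedModule.Class K (Lip0 X E) lip0_NormedModule_class
      lip0_CompleteSpace_mixin) (Lip0 X E).

End LipSpace.

Arguments lip0_CompleteNormedModule {K} X E.

Notation Lip0_banach := lip0_CompleteNormedModule.

(* Coquelicot's [is_linear] includes boundedness. *)
Record bounded_op {K : AbsRing} (E F : CompleteNormedModule K) := MkBoundedOp {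
  op_fun :> E -> F;
  op_linear : is_linear op_fun
}.

Arguments MkBoundedOp {K E F}.
Arguments op_fun {K E F}.
Arguments op_linear {K E F}.

Definition op_norm {K : AbsRing} {E F : CompleteNormedModule K}
    (w : bounded_op E F) : R :=
  least_bound (fun M => forall x : E, norm (w x) <= M * norm x).

Lemma op_minus {K : AbsRing} {E F : CompleteNormedModule K}
    (w : bounded_op E F) (x y : E) : w (minus x y) = minus (w x) (w y).
Proof.
unfold minus; rewrite (linear_plus _ (op_linear w)); f_equal.
rewrite -(@scal_opp_one K E) -(@scal_opp_one K F).
exact (linear_scal _ (op_linear w) _ _).
Qed.

Lemma op_zero {K : AbsRing} {E F : CompleteNormedModule K}
    (w : bounded_op E F) : w zero = zero.
Proof.
rewrite -(@scal_zero_r K E zero) (linear_scal _ (op_linear w)).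
apply (@scal_zero_l K F).
Qed.

Section Comp.
Context {K : AbsRing} {Y X : pointed_metric} {E F : CompleteNormedModule K}.
Variables (w : bounded_op E F) (T : Lip0 X E) (S : Lip0 Y X).

Lemma lip_comp_bound :
  exists L, lipschitz_with (X := Y) (Y := F) (fun y => w (T (S y))) L.
Proof.
destruct (linear_norm _ (op_linear w)) as [M [M0 HM]].
exists (M * (Lip T * Lip S)); intros y y'; simpl; unfold norm_dist.
rewrite -op_minus.
apply Rle_trans with (1 := HM _).
rewrite !Rmult_assoc; apply Rmult_le_compat_l; [lra|].
apply Rle_trans with (1 := Lip_spec T (S y) (S y')).
apply Rmult_le_compat_l; [apply Lip_ge0 | exact (Lip_spec S y y')].
Qed.

Lemma lip_comp_base : w (T (S (base_point Y))) = base_point F.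
Proof. rewrite !lip_base; apply op_zero. Qed.

Definition lip_comp : Lip0 Y F :=
  MkLip0 (Y := F) (fun y => w (T (S y))) lip_comp_bound lip_comp_base.
End Comp.

(* [scalar_banach k] has [scalars k] as carrier, but this is only visible once
   [k] is a constructor; [scalar_val] is the identity. *)
Definition scalar_val {k : scalar_field} (a : scalar_banach k) : scalars k :=
  match k return scalar_banach k -> scalars k with
  | real_scalars => fun a => a
  | complex_scalars => fun a => a
  end a.

Lemma abs_scalar_val_minus {k : scalar_field} (a b : scalar_banach k) :
  abs (minus (scalar_val a) (scalar_val b)) = norm (minus a b).
Proof. now destruct k. Qed.

Lemma scalar_val_zero {k : scalar_field} :
  scalar_val (zero : scalar_banach k) = zero.
Proof. now destruct k. Qed.

Section RankOne.
Context {k : scalar_field} {X : pointed_metric}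
  {E : CompleteNormedModule (scalars k)}.
Variables (v : E) (g : Lip0 X (scalar_banach k)).

Lemma rank_one_bound :
  exists L, lipschitz_with (X := X) (Y := E)
    (fun x => scal (scalar_val (g x)) v) L.
Proof.
exists (Lip g * norm v); intros x x'; simpl; unfold norm_dist.
rewrite -(@scal_minus_distr_r _ E).
apply Rle_trans with (1 := @norm_scal _ E _ _).
rewrite abs_scalar_val_minus.
assert (H := Lip_spec g x x'); simpl in H; unfold norm_dist in H.
apply Rle_trans with (Lip g * dist X x x' * norm v);
  [|apply Req_le; ring].
apply Rmult_le_compat_r; [apply norm_ge_0 | exact H].
Qed.

Lemma rank_one_base : scal (scalar_val (g (base_point X))) v = base_point E.
Proof.
rewrite lip_base; simpl; rewrite scalar_val_zero; apply (@scal_zero_l _ E).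
Qed.

Definition rank_one : Lip0 X E :=
  MkLip0 (Y := E) (fun x => scal (scalar_val (g x)) v) rank_one_bound
    rank_one_base.
End RankOne.

Lemma lip_id_bound (X : pointed_metric) :
  exists L, lipschitz_with (fun x : X => x) L.
Proof. exists 1; intros x x'; lra. Qed.

Definition lip_id (X : pointed_metric) : Lip0 X X :=
  MkLip0 (fun x : X => x) (lip_id_bound X) eq_refl.

Record lip_operator_ideal (k : scalar_field) := {
  ideal_mem : forall {X : pointed_metric}
    {E : CompleteNormedModule (scalars k)}, Lip0 X E -> Prop;
  ideal_subspace : forall (X : pointed_metric)
    (E : CompleteNormedModule (scalars k)),
    linear_subspace (fun T : Lip0 X E => ideal_mem T);
  ideal_rank_one : forall (X : pointed_metric)
    (E : CompleteNormedModule (scalars k)) (v : E)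
    (g : Lip0 X (scalar_banach k)), ideal_mem (rank_one v g);
  ideal_comp : forall (Y X : pointed_metric)
    (E F : CompleteNormedModule (scalars k))
    (S : Lip0 Y X) (T : Lip0 X E) (w : bounded_op E F),
    ideal_mem T -> ideal_mem (lip_comp w T S)
}.

Arguments ideal_mem {k} _ {X E}.

(* [ideal_norm] is a total function; its values outside the ideal are
   irrelevant. *)
Record normed_lip_ideal (k : scalar_field) := {
  underlying_ideal :> lip_operator_ideal k;
  ideal_norm : forall {X : pointed_metric}
    {E : CompleteNormedModule (scalars k)}, Lip0 X E -> R;
  ideal_norm_is_norm : forall (X : pointed_metric)
    (E : CompleteNormedModule (scalars k)),
    is_norm_on (fun T : Lip0 X E => ideal_mem underlying_ideal T)
      (fun T : Lip0 X E => ideal_norm T);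
  ideal_norm_Lip : forall (X : pointed_metric)
    (E : CompleteNormedModule (scalars k)) (T : Lip0 X E),
    ideal_mem underlying_ideal T -> Lip T <= ideal_norm T;
  ideal_norm_id : ideal_norm (lip_id (scalar_banach k)) = 1;
  ideal_norm_comp : forall (Y X : pointed_metric)
    (E F : CompleteNormedModule (scalars k))
    (S : Lip0 Y X) (T : Lip0 X E) (w : bounded_op E F),
    ideal_mem underlying_ideal T ->
    ideal_norm (lip_comp w T S) <= Lip S * ideal_norm T * op_norm w
}.

Arguments ideal_norm {k} _ {X E}.

Definition quad_diff {G : AbelianGroup} (a b c e : G) : G :=
  plus (minus (minus a b) c) e.

Lemma quad_diff_minus {G : AbelianGroup} (a b c e : G) :
  quad_diff a b c e = minus (minus a b) (minus c e).
Proof.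
unfold quad_diff, minus at 1 3.
now rewrite opp_minus /minus -!plus_assoc (plus_comm e).
Qed.

Lemma minus_minus_swap {G : AbelianGroup} (a b c e : G) :
  minus (minus a b) (minus c e) = minus (minus a c) (minus b e).
Proof.
rewrite {2}/minus minus_plus_plus minus_opp_opp; reflexivity.
Qed.

Lemma quad_diff_swap {G : AbelianGroup} (a b c e : G) :
  quad_diff a b c e = quad_diff a c b e.
Proof. now rewrite !quad_diff_minus minus_minus_swap. Qed.

Lemma quad_diff_plus {G : AbelianGroup} (a b c e a' b' c' e' : G) :
  quad_diff (plus a a') (plus b b') (plus c c') (plus e e') =
  plus (quad_diff a b c e) (quad_diff a' b' c' e').
Proof. now rewrite !quad_diff_minus !minus_plus_plus. Qed.

Lemma quad_diff_opp {G : AbelianGroup} (a b c e : G) :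
  quad_diff (opp a) (opp b) (opp c) (opp e) = opp (quad_diff a b c e).
Proof. now rewrite !quad_diff_minus !minus_opp_opp. Qed.

Lemma quad_diff_zero {G : AbelianGroup} :
  quad_diff zero zero zero zero = zero :> G.
Proof. now rewrite quad_diff_minus !minus_eq_zero. Qed.

Lemma quad_diff_zero_r {G : AbelianGroup} (a b : G) :
  quad_diff a b zero zero = minus a b.
Proof. now rewrite quad_diff_minus minus_eq_zero minus_zero_r. Qed.

Lemma quad_diff_scal {K : Ring} {V : ModuleSpace K} (l : K) (a b c e : V) :
  quad_diff (scal l a) (scal l b) (scal l c) (scal l e) =
  scal l (quad_diff a b c e).
Proof. now rewrite !quad_diff_minus !scal_minus_distr_l. Qed.

Record BLip0 {K : AbsRing} (X1 X2 : pointed_metric)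
    (E : CompleteNormedModule K) := MkBLip0 {
  blip_fun :> X1 -> X2 -> E;
  blip_base_r : forall x1, blip_fun x1 (base_point X2) = zero;
  blip_base_l : forall x2, blip_fun (base_point X1) x2 = zero;
  blip_bound : exists C : R, 0 < C /\ forall x1 x1' x2 x2',
    norm (quad_diff (blip_fun x1 x2) (blip_fun x1 x2')
                    (blip_fun x1' x2) (blip_fun x1' x2'))
    <= C * dist X1 x1 x1' * dist X2 x2 x2'
}.

Arguments MkBLip0 {K X1 X2 E}.
Arguments blip_fun {K X1 X2 E}.
Arguments blip_base_r {K X1 X2 E}.
Arguments blip_base_l {K X1 X2 E}.
Arguments blip_bound {K X1 X2 E}.

Section BLipSpace.
Context {K : AbsRing} {X1 X2 : pointed_metric} {E : CompleteNormedModule K}.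
Implicit Types T U : BLip0 X1 X2 E.

Lemma BLip0_ext T U : (forall x1 x2, T x1 x2 = U x1 x2) -> T = U.
Proof.
destruct T as [T Tr Tl Tb], U as [U Ur Ul Ub]; simpl; intros H.
assert (T = U) by
  (apply functional_extensionality; intros x1;
   apply functional_extensionality; apply H).
subst U; f_equal; apply proof_irrelevance.
Qed.

Lemma dist_mul_ge0 (x1 x1' : X1) (x2 x2' : X2) :
  0 <= dist X1 x1 x1' * dist X2 x2 x2'.
Proof. apply Rmult_le_pos; apply Rge_le, dist_pos. Qed.

Definition blip_zero : BLip0 X1 X2 E.
Proof.
refine (MkBLip0 (fun _ _ => zero) (fun _ => eq_refl) (fun _ => eq_refl) _).
exists 1; split; [lra|]; intros x1 x1' x2 x2'.
rewrite quad_diff_zero (@norm_zero K E) Rmult_1_l; apply dist_mul_ge0.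
Defined.

Definition blip_plus T U : BLip0 X1 X2 E.
Proof.
refine (MkBLip0 (fun x1 x2 => plus (T x1 x2) (U x1 x2)) _ _ _).
- intros x1; rewrite !blip_base_r; apply (@plus_zero_l E).
- intros x2; rewrite !blip_base_l; apply (@plus_zero_l E).
- destruct (blip_bound T) as [C [C0 HC]], (blip_bound U) as [D [D0 HD]].
  exists (C + D); split; [lra|]; intros x1 x1' x2 x2'.
  rewrite quad_diff_plus; apply Rle_trans with (1 := @norm_triangle K E _ _).
  rewrite !Rmult_plus_distr_r.
  exact (Rplus_le_compat _ _ _ _ (HC x1 x1' x2 x2') (HD x1 x1' x2 x2')).
Defined.

Definition blip_opp T : BLip0 X1 X2 E.
Proof.
refine (MkBLip0 (fun x1 x2 => opp (T x1 x2)) _ _ _).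
- intros x1; rewrite blip_base_r; apply (@opp_zero E).
- intros x2; rewrite blip_base_l; apply (@opp_zero E).
- destruct (blip_bound T) as [C [C0 HC]].
  exists C; split; [exact C0|]; intros x1 x1' x2 x2'.
  rewrite quad_diff_opp norm_opp; apply HC.
Defined.

Definition blip_scal (a : K) T : BLip0 X1 X2 E.
Proof.
refine (MkBLip0 (fun x1 x2 => scal a (T x1 x2)) _ _ _).
- intros x1; rewrite blip_base_r; apply (@scal_zero_r K E).
- intros x2; rewrite blip_base_l; apply (@scal_zero_r K E).
- destruct (blip_bound T) as [C [C0 HC]].
  assert (a0 := abs_ge_0 a).
  exists (abs a * C + 1); split.
  { assert (H := Rmult_le_pos _ _ a0 (Rlt_le _ _ C0)); lra. }
  intros x1 x1' x2 x2'.
  rewrite (@quad_diff_scal K E).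
  apply Rle_trans with (1 := @norm_scal K E _ _).
  apply Rle_trans with (abs a * (C * dist X1 x1 x1' * dist X2 x2 x2')).
  + apply Rmult_le_compat_l; [exact a0 | apply HC].
  + assert (H := dist_mul_ge0 x1 x1' x2 x2'); lra.
Defined.

Lemma blip_plus_comm T U : blip_plus T U = blip_plus U T.
Proof. apply BLip0_ext; intros x1 x2; apply (@plus_comm E). Qed.

Lemma blip_plus_assoc T U V :
  blip_plus T (blip_plus U V) = blip_plus (blip_plus T U) V.
Proof. apply BLip0_ext; intros x1 x2; apply (@plus_assoc E). Qed.

Lemma blip_plus_zero_r T : blip_plus T blip_zero = T.
Proof. apply BLip0_ext; intros x1 x2; apply (@plus_zero_r E). Qed.

Lemma blip_plus_opp_r T : blip_plus T (blip_opp T) = blip_zero.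
Proof. apply BLip0_ext; intros x1 x2; apply (@plus_opp_r E). Qed.

Definition blip_AbelianMonoid_mixin :=
  AbelianMonoid.Mixin (BLip0 X1 X2 E) blip_plus blip_zero blip_plus_comm
    blip_plus_assoc blip_plus_zero_r.

Canonical blip_AbelianMonoid :=
  AbelianMonoid.Pack (BLip0 X1 X2 E) blip_AbelianMonoid_mixin (BLip0 X1 X2 E).

Definition blip_AbelianGroup_class :=
  AbelianGroup.Class _ blip_AbelianMonoid_mixin
    (AbelianGroup.Mixin blip_AbelianMonoid blip_opp blip_plus_opp_r).

Canonical blip_AbelianGroup :=
  AbelianGroup.Pack (BLip0 X1 X2 E) blip_AbelianGroup_class (BLip0 X1 X2 E).

Lemma blip_scal_assoc (a b : K) T :
  blip_scal a (blip_scal b T) = blip_scal (mult a b) T.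
Proof. apply BLip0_ext; intros x1 x2; apply (@scal_assoc K E). Qed.

Lemma blip_scal_one T : blip_scal one T = T.
Proof. apply BLip0_ext; intros x1 x2; apply (@scal_one K E). Qed.

Lemma blip_scal_distr_l (a : K) T U :
  blip_scal a (blip_plus T U) = blip_plus (blip_scal a T) (blip_scal a U).
Proof. apply BLip0_ext; intros x1 x2; apply (@scal_distr_l K E). Qed.

Lemma blip_scal_distr_r (a b : K) T :
  blip_scal (plus a b) T = blip_plus (blip_scal a T) (blip_scal b T).
Proof. apply BLip0_ext; intros x1 x2; apply (@scal_distr_r K E). Qed.

Definition blip_ModuleSpace_mixin :=
  ModuleSpace.Mixin K blip_AbelianGroup blip_scal blip_scal_assoc
    blip_scal_one blip_scal_distr_l blip_scal_distr_r.

Canonical blip_ModuleSpace :=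
  ModuleSpace.Pack K (BLip0 X1 X2 E)
    (ModuleSpace.Class K (BLip0 X1 X2 E) blip_AbelianGroup_class
      blip_ModuleSpace_mixin) (BLip0 X1 X2 E).

End BLipSpace.

Section Associated.
Context {K : AbsRing} {E : CompleteNormedModule K}.

Definition blip_flip {X1 X2 : pointed_metric} (T : BLip0 X1 X2 E) :
  BLip0 X2 X1 E.
Proof.
refine (MkBLip0 (fun x2 x1 => T x1 x2) (blip_base_l T) (blip_base_r T) _).
destruct (blip_bound T) as [C [C0 HC]].
exists C; split; [exact C0|]; intros x2 x2' x1 x1'.
rewrite quad_diff_swap.
replace (C * dist X2 x2 x2' * dist X1 x1 x1')
  with (C * dist X1 x1 x1' * dist X2 x2 x2') by ring.
apply HC.
Defined.

Context {X1 X2 : pointed_metric}.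

Definition blip_partial (T : BLip0 X1 X2 E) (x1 : X1) : Lip0 X2 E.
Proof.
refine (MkLip0 (Y := E) (fun x2 => T x1 x2) _ (blip_base_r T x1)).
destruct (blip_bound T) as [C [C0 HC]].
exists (C * dist X1 x1 (base_point X1)); intros x2 x2'.
simpl; unfold norm_dist.
assert (H := HC x1 (base_point X1) x2 x2').
rewrite !blip_base_l quad_diff_zero_r in H; exact H.
Defined.

(* T_1 : x1 |-> T(x1, .) *)
Definition assoc1 (T : BLip0 X1 X2 E) : Lip0 X1 (Lip0_banach X2 E).
Proof.
refine (MkLip0 (Y := Lip0_banach X2 E) (blip_partial T) _ _).
- destruct (blip_bound T) as [C [C0 HC]].
  exists C; intros x1 x1'.
  apply Lip_le.
  { apply Rmult_le_pos; [lra | apply Rge_le, dist_pos]. }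
  intros x2 x2'; simpl; unfold norm_dist.
  apply Rle_trans with (2 := HC x1 x1' x2 x2').
  rewrite quad_diff_minus minus_minus_swap; apply Rle_refl.
- apply Lip0_ext; intros x2; apply (blip_base_l T).
Defined.

End Associated.

(* T_2 : x2 |-> T(., x2) *)
Definition assoc2 {K : AbsRing} {E : CompleteNormedModule K}
    {X1 X2 : pointed_metric} (T : BLip0 X1 X2 E) :
    Lip0 X2 (Lip0_banach X1 E) :=
  assoc1 (blip_flip T).

Definition lipschitzization {k : scalar_field} (I1 I2 : lip_operator_ideal k)
    {X1 X2 : pointed_metric} {E : CompleteNormedModule (scalars k)}
    (T : BLip0 X1 X2 E) : Prop :=
  ideal_mem I1 (assoc1 T) /\ ideal_mem I2 (assoc2 T).

Definition lipschitzization_norm {k : scalar_field}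
    (I1 I2 : normed_lip_ideal k)
    {X1 X2 : pointed_metric} {E : CompleteNormedModule (scalars k)}
    (T : BLip0 X1 X2 E) : R :=
  Rmax (ideal_norm I1 (assoc1 T)) (ideal_norm I2 (assoc2 T)).

Definition blip_comp {K : AbsRing} {Z W X1 X2 : pointed_metric}
    {E F : CompleteNormedModule K}
    (u : bounded_op E F) (T : BLip0 X1 X2 E) (f : Lip0 Z X1) (g : Lip0 W X2) :
    BLip0 Z W F.
Proof.
refine (MkBLip0 (fun z w => u (T (f z) (g w))) _ _ _).
- intros z; rewrite lip_base blip_base_r; apply op_zero.
- intros w; rewrite lip_base blip_base_l; apply op_zero.
- destruct (blip_bound T) as [C [C0 HC]].
  destruct (linear_norm _ (op_linear u)) as [M [M0 HM]].
  assert (f0 := Lip_ge0 f); assert (g0 := Lip_ge0 g).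
  exists (M * C * ((Lip f + 1) * (Lip g + 1))); split.
  { repeat apply Rmult_lt_0_compat; lra. }
  intros z z' w w'.
  replace (quad_diff (u (T (f z) (g w))) (u (T (f z) (g w')))
             (u (T (f z') (g w))) (u (T (f z') (g w'))))
    with (u (quad_diff (T (f z) (g w)) (T (f z) (g w'))
             (T (f z') (g w)) (T (f z') (g w'))))
    by now rewrite !quad_diff_minus !op_minus.
  apply Rle_trans with (1 := HM _).
  assert (df := Lip_spec f z z'); assert (dg := Lip_spec g w w').
  assert (dz := dist_pos Z z z'); assert (dw := dist_pos W w w').
  assert (df0 := dist_pos X1 (f z) (f z')).
  assert (dg0 := dist_pos X2 (g w) (g w')).
  apply Rle_trans with
    (M * (C * dist X1 (f z) (f z') * dist X2 (g w) (g w'))).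
  { apply Rmult_le_compat_l; [lra | apply HC]. }
  apply Rle_trans with
    (M * C * (((Lip f + 1) * dist Z z z') * ((Lip g + 1) * dist W w w')));
    [|apply Req_le; ring].
  rewrite Rmult_assoc -Rmult_assoc.
  apply Rmult_le_compat_l; [apply Rmult_le_pos; lra|].
  apply Rmult_le_compat; lra.
Defined.

(* Main.v *)
Require Import Defs.
From Stdlib Require Import Reals Lra.
From Coquelicot Require Import Coquelicot.

Local Open Scope R_scope.

(** Everything about a two-Lipschitz map [T] is read off its two associated
    maps.  The maps [T |-> T_1] and [T |-> T_2] are linear and injective
    ([assoc1_plus], [assoc1_scal], [assoc1_eq_zero] and their [assoc2]
    versions), so the preimage of each ideal component is a linear subspace and
    each ideal norm pulls back to a norm on it; intersecting the two preimages
    and taking the maximum of the two norms preserves these properties.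

    For the ideal property, a pair [u : E -> F], [g : W -> X2] induces a bounded
    operator [h |-> u o h o g] from [Lip0 X2 E] to [Lip0 W F], of norm at most
    [op_norm u * Lip g] ([conj_op], [conj_op_norm_le]).  The first associated
    map of [u o T o (f, g)] is this operator after [T_1] after [f]
    ([assoc1_comp]), so the ideal property of the first ideal applies.
    Exchanging the two variables turns the second associated map of [T] into
    the first one of the flipped map, with [f] and [g] exchanged
    ([blip_flip_comp]), and reduces the second ideal to the same estimate. *)

(** * Linear subspaces and norms *)

Section SubspacesAndNorms.
Context {K : AbsRing} {V : ModuleSpace K}.

Lemma linear_subspace_inter (P Q : V -> Prop) :
  linear_subspace P -> linear_subspace Q ->
  linear_subspace (fun x => P x /\ Q x).
Proof.
intros [P0 [Pp Ps]] [Q0 [Qp Qs]]; repeat split; try tauto.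
- apply Pp; tauto.
- apply Qp; tauto.
- apply Ps; tauto.
- apply Qs; tauto.
Qed.

Lemma is_norm_on_max (P Q : V -> Prop) (n m : V -> R) :
  is_norm_on P n -> is_norm_on Q m ->
  is_norm_on (fun x => P x /\ Q x) (fun x => Rmax (n x) (m x)).
Proof.
intros [n0 [nz [ns np]]] [m0 [mz [ms mp]]]; split; [|split; [|split]].
- intros x [Px _]; apply Rle_trans with (1 := n0 x Px), Rmax_l.
- intros x [Px Qx]; split; intros H.
  + apply (nz x Px), Rle_antisym; [|exact (n0 x Px)].
    rewrite <- H; apply Rmax_l.
  + rewrite (proj2 (nz x Px) H), (proj2 (mz x Qx) H).
    apply Rmax_left, Rle_refl.
- intros a x [Px Qx]; rewrite (ns a x Px), (ms a x Qx).
  apply RmaxRmult, abs_ge_0.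
- intros x y [Px Qx] [Py Qy]; apply Rmax_lub.
  + apply Rle_trans with (1 := np x y Px Py).
    apply Rplus_le_compat; apply Rmax_l.
  + apply Rle_trans with (1 := mp x y Qx Qy).
    apply Rplus_le_compat; apply Rmax_r.
Qed.

Context {W : ModuleSpace K} (phi : V -> W).
Hypothesis phi_plus : forall x y, phi (plus x y) = plus (phi x) (phi y).
Hypothesis phi_scal : forall a x, phi (scal a x) = scal a (phi x).

Lemma additive_homogeneous_zero : phi zero = zero.
Proof. rewrite <- (scal_zero_l (K := K) zero), phi_scal; apply scal_zero_l. Qed.

Lemma linear_subspace_preimage (P : W -> Prop) :
  linear_subspace P -> linear_subspace (fun x => P (phi x)).
Proof.
intros [P0 [Pp Ps]]; repeat split.
- now rewrite additive_homogeneous_zero.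
- intros x y Px Py; rewrite phi_plus; now apply Pp.
- intros a x Px; rewrite phi_scal; now apply Ps.
Qed.

Lemma is_norm_on_preimage (P : W -> Prop) (n : W -> R) :
  (forall x, phi x = zero -> x = zero) ->
  is_norm_on P n -> is_norm_on (fun x => P (phi x)) (fun x => n (phi x)).
Proof.
intros phi_inj [n0 [nz [ns np]]]; split; [|split; [|split]].
- intros x; apply n0.
- intros x Px; split; intros H.
  + now apply phi_inj, nz.
  + now apply nz; [|rewrite H; apply additive_homogeneous_zero].
- intros a x Px; rewrite phi_scal; now apply ns.
- intros x y Px Py; rewrite phi_plus; now apply np.
Qed.

End SubspacesAndNorms.

(** * Linearity and injectivity of the associated maps *)

Section AssociatedLinear.
Context {K : AbsRing} {X1 X2 : pointed_metric} {E : CompleteNormedModule K}.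
Implicit Types T U : BLip0 X1 X2 E.

Lemma assoc1_plus T U : assoc1 (plus T U) = plus (assoc1 T) (assoc1 U).
Proof. now apply Lip0_ext; intros x1; apply Lip0_ext. Qed.

Lemma assoc1_scal (a : K) T : assoc1 (scal a T) = scal a (assoc1 T).
Proof. now apply Lip0_ext; intros x1; apply Lip0_ext. Qed.

Lemma assoc1_eq_zero T : assoc1 T = zero -> T = zero.
Proof.
intros H; apply BLip0_ext; intros x1 x2.
exact (f_equal (fun S : Lip0 X1 (Lip0_banach X2 E) =>
  lip_fun (lip_fun S x1 : Lip0 X2 E) x2) H).
Qed.

Lemma assoc2_plus T U : assoc2 (plus T U) = plus (assoc2 T) (assoc2 U).
Proof. now apply Lip0_ext; intros x2; apply Lip0_ext. Qed.

Lemma assoc2_scal (a : K) T : assoc2 (scal a T) = scal a (assoc2 T).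
Proof. now apply Lip0_ext; intros x2; apply Lip0_ext. Qed.

Lemma assoc2_eq_zero T : assoc2 T = zero -> T = zero.
Proof.
intros H; apply BLip0_ext; intros x1 x2.
exact (f_equal (fun S : Lip0 X2 (Lip0_banach X1 E) =>
  lip_fun (lip_fun S x2 : Lip0 X1 E) x1) H).
Qed.

End AssociatedLinear.

(** * The operator induced on Lipschitz spaces *)

Section OperatorNorm.
Context {K : AbsRing} {E F : CompleteNormedModule K} (u : bounded_op E F).

Lemma op_norm_ge0 : 0 <= op_norm u.
Proof. apply least_bound_ge0. Qed.

(** The infimum defining the operator norm is attained: for [norm x > 0] every
    bound is at least [norm (u x) / norm x], and for [norm x = 0] any bound
    gives [norm (u x) <= 0]. *)
Lemma op_norm_spec (x : E) : norm (u x) <= op_norm u * norm x.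
Proof.
destruct (linear_norm _ (op_linear u)) as [M [M0 HM]].
destruct (Rle_lt_or_eq_dec 0 (norm x) (norm_ge_0 x)) as [Hx | Hx].
- apply Rle_div_l; [exact Hx|].
  apply least_bound_glb.
  + exists M; split; [now apply Rlt_le | exact HM].
  + intros c _ Hc; apply Rle_div_l; [exact Hx | apply Hc].
- generalize (HM x); rewrite <- Hx; lra.
Qed.

End OperatorNorm.

Section ConjugationOperator.
Context {K : AbsRing} {W X : pointed_metric} {E F : CompleteNormedModule K}.
Variables (u : bounded_op E F) (g : Lip0 W X).

Lemma Lip_comp_le (h : Lip0 X E) :
  Lip (lip_comp u h g) <= op_norm u * Lip g * Lip h.
Proof.
assert (u0 := op_norm_ge0 u); assert (g0 := Lip_ge0 g).
assert (h0 := Lip_ge0 h).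
apply Lip_le.
{ repeat apply Rmult_le_pos; assumption. }
intros w w'; simpl; unfold norm_dist; rewrite <- op_minus.
apply Rle_trans with (1 := op_norm_spec u _).
rewrite !Rmult_assoc; apply Rmult_le_compat_l; [exact u0|].
apply Rle_trans with (1 := Lip_spec h (g w) (g w')).
apply Rle_trans with (Lip h * (Lip g * dist W w w')); [|apply Req_le; ring].
apply Rmult_le_compat_l; [exact h0 | apply Lip_spec].
Qed.

Lemma lip_comp_is_linear :
  is_linear (U := Lip0_banach X E) (V := Lip0_banach W F)
    (fun h : Lip0 X E => lip_comp u h g).
Proof.
split.
- intros h h'; apply Lip0_ext; intros w.
  exact (linear_plus _ (op_linear u) _ _).
- intros a h; apply Lip0_ext; intros w.
  exact (linear_scal _ (op_linear u) _ _).
(* The bound must be positive, while [op_norm u * Lip g] may vanish. *)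
- exists (op_norm u * Lip g + 1); split.
  { assert (H := Rmult_le_pos _ _ (op_norm_ge0 u) (Lip_ge0 g)); lra. }
  intros h; change (Lip (lip_comp u h g) <= (op_norm u * Lip g + 1) * Lip h).
  generalize (Lip_comp_le h) (Lip_ge0 h); lra.
Qed.

Definition conj_op : bounded_op (Lip0_banach X E) (Lip0_banach W F) :=
  MkBoundedOp _ lip_comp_is_linear.

Lemma conj_op_norm_le : op_norm conj_op <= op_norm u * Lip g.
Proof.
apply least_bound_le.
- apply Rmult_le_pos; [apply op_norm_ge0 | apply Lip_ge0].
- exact Lip_comp_le.
Qed.

End ConjugationOperator.

(** * Composition with Lipschitz maps and an operator *)

Section Composition.
Context {K : AbsRing} {Z W X1 X2 : pointed_metric}.
Context {E F : CompleteNormedModule K}.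

Lemma assoc1_comp (u : bounded_op E F) (T : BLip0 X1 X2 E) (f : Lip0 Z X1)
    (g : Lip0 W X2) :
  assoc1 (blip_comp u T f g) = lip_comp (conj_op u g) (assoc1 T) f.
Proof. now apply Lip0_ext; intros z; apply Lip0_ext. Qed.

Lemma blip_flip_comp (u : bounded_op E F) (T : BLip0 X1 X2 E) (f : Lip0 Z X1)
    (g : Lip0 W X2) :
  blip_flip (blip_comp u T f g) = blip_comp u (blip_flip T) g f.
Proof. now apply BLip0_ext. Qed.

End Composition.

Section IdealProperty.
Context {k : scalar_field} {Z W X1 X2 : pointed_metric}.
Context {E F : CompleteNormedModule (scalars k)}.
Variables (u : bounded_op E F) (T : BLip0 X1 X2 E).
Variables (f : Lip0 Z X1) (g : Lip0 W X2).

Lemma assoc1_comp_mem (I : lip_operator_ideal k) :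
  ideal_mem I (assoc1 T) -> ideal_mem I (assoc1 (blip_comp u T f g)).
Proof. rewrite assoc1_comp; apply ideal_comp. Qed.

Lemma assoc1_comp_norm_le (I : normed_lip_ideal k) :
  ideal_mem I (assoc1 T) ->
  ideal_norm I (assoc1 (blip_comp u T f g))
    <= op_norm u * ideal_norm I (assoc1 T) * Lip f * Lip g.
Proof.
intros HT; rewrite assoc1_comp.
apply Rle_trans with (1 := ideal_norm_comp _ I _ _ _ _ _ _ _ HT).
assert (n0 := proj1 (ideal_norm_is_norm _ I _ _) _ HT).
apply Rle_trans with
  (Lip f * ideal_norm I (assoc1 T) * (op_norm u * Lip g));
  [|apply Req_le; ring].
apply Rmult_le_compat_l; [|apply conj_op_norm_le].
apply Rmult_le_pos; [apply Lip_ge0 | exact n0].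
Qed.

End IdealProperty.

Theorem proposition5p3 (k : scalar_field) (I1 I2 : normed_lip_ideal k)
    (X1 X2 : pointed_metric) (E : CompleteNormedModule (scalars k)) :
  linear_subspace (fun T : BLip0 X1 X2 E => lipschitzization I1 I2 T) /\
  is_norm_on (fun T : BLip0 X1 X2 E => lipschitzization I1 I2 T)
    (fun T : BLip0 X1 X2 E => lipschitzization_norm I1 I2 T) /\
  (forall (Z W : pointed_metric) (F : CompleteNormedModule (scalars k))
      (f : Lip0 Z X1) (g : Lip0 W X2) (u : bounded_op E F)
      (T : BLip0 X1 X2 E),
    lipschitzization I1 I2 T ->
    lipschitzization I1 I2 (blip_comp u T f g) /\
    lipschitzization_norm I1 I2 (blip_comp u T f g)
      <= op_norm u * lipschitzization_norm I1 I2 T * Lip f * Lip g).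
Proof.
split; [|split].
- exact (linear_subspace_inter _ _
    (linear_subspace_preimage _ assoc1_plus assoc1_scal _
      (ideal_subspace _ I1 _ _))
    (linear_subspace_preimage _ assoc2_plus assoc2_scal _
      (ideal_subspace _ I2 _ _))).
- exact (is_norm_on_max _ _ _ _
    (is_norm_on_preimage _ assoc1_plus assoc1_scal _ _ assoc1_eq_zero
      (ideal_norm_is_norm _ I1 _ _))
    (is_norm_on_preimage _ assoc2_plus assoc2_scal _ _ assoc2_eq_zero
      (ideal_norm_is_norm _ I2 _ _))).
- intros Z W F f g u T [H1 H2].
  unfold lipschitzization, lipschitzization_norm, assoc2 in *.
  rewrite blip_flip_comp.
  split.
  + split; now apply assoc1_comp_mem.
  + assert (N1 := assoc1_comp_norm_le u T f g I1 H1).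
    assert (N2 := assoc1_comp_norm_le u (blip_flip T) g f I2 H2).
    assert (mono : forall a b, a <= b ->
        op_norm u * a * Lip f * Lip g <= op_norm u * b * Lip f * Lip g).
    { intros a b Hab.
      repeat (apply Rmult_le_compat_r; [apply Lip_ge0|]).
      apply Rmult_le_compat_l; [apply op_norm_ge0 | exact Hab]. }
    apply Rmax_lub.
    * apply Rle_trans with (1 := N1), mono, Rmax_l.
    * apply Rle_trans with (1 := N2).
      rewrite Rmult_assoc, (Rmult_comm (Lip g)), <- Rmult_assoc.
      apply mono, Rmax_r.
Qed.
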